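(* Let $f\in\mathbb{R}[\mathbf{x}]$, $\mathbf{x}=(x_1,\dots,x_n)$, have a correlative sparsity pattern $(\mathbf{x}(1),\dots,\mathbf{x}(p))$. Assume that $f>0$ on $\mathbb{R}^n$ and that $f^{(\infty)}$ is positive definite. Then there exist $\sigma_{\ell,0}\in\Sigma[\mathbf{u}(\ell)]$ for each $\ell\in\{1,\dots,q\}$, $\sigma_{\ell,i}\in\Sigma[\mathbf{u}(\ell)]$ for each $\ell\in\{1,\dots,q\}$ and each $u_i\in\mathbf{u}(\ell)$, and $\tau_{\ell,j}\in\mathbb{R}[\mathbf{u}(\ell)]$ for each $\ell\in\{1,\dots,q\}$ and $j\in I_\ell$, such that $$\tilde f=\sum_{\ell=1}^q\left(\sigma_{\ell,0}+\sum_{u_i\in\mathbf{u}(\ell)}\sigma_{\ell,i}(1-u_i^2)+\sum_{j\in I_\ell}\tau_{\ell,j}h'_j\right).$$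
   Context: Put $d=\deg(f)$. Let $x_0$ be a homogenization variable, $\tilde{\mathbf{x}}=(x_0,x_1,\dots,x_n)$, $\tilde f(\tilde{\mathbf{x}})=x_0^df(\mathbf{x}/x_0)$, and $f^{(\infty)}$ the homogeneous part of $f$ of degree $d$. A form is positive definite if it is $>0$ at every nonzero point. For a set of variables $V$, $\Sigma[V]$ denotes the sums of squares in $\mathbb{R}[V]$. Correlative sparsity pattern: $\mathbf{x}(\ell)\subseteq\{x_1,\dots,x_n\}$, $\bigcup_{\ell=1}^p\mathbf{x}(\ell)=\{x_1,\dots,x_n\}$, and $f=\sum_{\ell=1}^pf_\ell$ with $f_\ell\in\mathbb{R}[\mathbf{x}(\ell)]$. Let $p_i$ be the number of $\ell$ with $x_i\in\mathbf{x}(\ell)$. Let $\mathbf{w}=(w_1,\dots,w_p)$ be auxiliary variables and $$h'_\ell=\sum_{x_i\in\mathbf{x}(\ell)}\tfrac1{p_i}x_i^2+\tfrac1p x_0^2+w_\ell^2-1\ (\ell=1,\dots,p),\qquad h'_{p+1}=\|\mathbf{w}\|^2-p+1.$$ Consider the problem (the case $K=\mathbb{R}^n$ of the paper's reformulation): maximize $\gamma$ subject to $\tilde f-\gamma x_0^d\ge0$ on the set of $(\tilde{\mathbf{x}},\mathbf{w})\in\mathbb{R}^{n+1+p}$ with $x_0\ge0$, $h'_\ell=0$ $(\ell=1,\dots,p+1)$, $1-x_i^2\ge0$ $(i=0,\dots,n)$, $1-w_\ell^2\ge0$ $(\ell=1,\dots,p)$. Let $\mathbf{u}=(\tilde{\mathbf{x}},\mathbf{w})$.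 The csp graph of this problem has the variables in $\mathbf{u}$ as vertices, two variables being adjacent if they occur together in a monomial of $\tilde f-\gamma x_0^d$ or both occur in the same constraint polynomial. Let $\mathbf{u}(1),\dots,\mathbf{u}(q)$ be the list of maximal cliques of some chordal extension (a chordal graph on the same vertices containing all edges) of this graph, and let $\{I_1,\dots,I_q\}$ be a partition of $\{1,\dots,p+1\}$ (parts may be empty) with $h'_j\in\mathbb{R}[\mathbf{u}(\ell)]$ for all $j\in I_\ell$. *)

(* Defs.v *)
From HB Require Import structures.
From mathcomp Require Import all_boot all_order all_algebra.
From mathcomp Require Import mpoly.
From mathcomp Require Import reals.

Set Implicit Arguments.
Unset Strict Implicit.
Unset Printing Implicit Defensive.

Import Order.TTheory GRing.Theory Num.Theory.
Local Open Scope ring_scope.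

Section Polynomials.
Context {R : realType} {N : nat}.
Implicit Types (g : {mpoly R[N]}) (V : {set 'I_N}).

Definition occurs (i : 'I_N) g : bool :=
  has (fun m : 'X_{1..N} => m i != 0%N) (msupp g).

(* g \in R[V] *)
Definition poly_in V g : Prop := forall i, occurs i g -> i \in V.

(* g \in \Sigma[V] *)
Definition sos_in V g : Prop :=
  exists s : seq {mpoly R[N]},
    (forall h, h \in s -> poly_in V h) /\ g = \sum_(h <- s) h ^+ 2.

(* [msize] is the degree plus one, and 0 for the zero polynomial. *)
Definition mpdeg g : nat := (msize g).-1.

(* f^(oo) *)
Definition top_form g : {mpoly R[N]} := pihomog mdeg (mpdeg g) g.

Definition positive_definite g : Prop :=
  forall x : 'I_N -> R, (exists i, x i != 0) -> 0 < g.@[x].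

End Polynomials.

Section Graphs.
Context {T : finType}.
Implicit Types (G : rel T) (A : {set T}).

(* Every simple cycle of length at least 4 has a chord; for irreflexive G,
   the two vertices x and y below are distinct. *)
Definition chordal G : Prop :=
  forall c : seq T, ucycle G c -> (3 < size c)%N ->
    exists x y, [/\ x \in c, y \in c, G x y, y != next c x & x != next c y].

Definition cliqueb G A : bool :=
  [forall x in A, forall y in A, (x != y) ==> G x y].

Definition chordal_extension (E : T -> T -> Prop) G : Prop :=
  [/\ ssrbool.symmetric G, irreflexive G, chordal G & forall x y, E x y -> G x y].

Definition lists_max_cliques G q (U : 'I_q -> {set T}) : Prop :=
  injective U /\ forall A, maxset (cliqueb G) A <-> exists l, U l = A.

End Graphs.

(* Parts may be empty. *)
Definition partition_family {T : finType} {q : nat} (I : 'I_q -> {set T}) :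
    Prop :=
  \bigcup_l I l = [set: T] /\ forall k l, k != l -> [disjoint I k & I l].

Definition csp_pattern {R : realType} {n p : nat} (xs : 'I_p -> {set 'I_n})
    (f : {mpoly R[n]}) : Prop :=
  \bigcup_l xs l = [set: 'I_n] /\
  exists fl : 'I_p -> {mpoly R[n]},
    (forall l, poly_in (xs l) (fl l)) /\ f = \sum_l fl l.

(* The variables u = (x_0, x_1, ..., x_n, w_1, ..., w_p) are numbered in this
   order by 'I_(n.+1 + p). *)
Definition iX0 (n p : nat) : 'I_(n.+1 + p) := lshift p ord0.
Definition iX {n : nat} (p : nat) (i : 'I_n) : 'I_(n.+1 + p) :=
  lshift p (lift ord0 i).
Definition iW (n : nat) {p : nat} (l : 'I_p) : 'I_(n.+1 + p) := rshift n.+1 l.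

Section Problem.
Context {R : realType} {n p : nat}.
Local Notation P := {mpoly R[n.+1 + p]}.

(* x_0 ^ d f(x / x_0), as a polynomial in u *)
Definition homogenization (f : {mpoly R[n]}) : P :=
  \sum_(m <- msupp f)
    f@_m *: ('X_(iX0 n p) ^+ (mpdeg f - mdeg m) *
             \prod_(i < n) 'X_(iX p i) ^+ m i).

Variable xs : 'I_p -> {set 'I_n}.

(* p_i *)
Definition multiplicity (i : 'I_n) : nat := #|[set l | i \in xs l]|.

Definition hl (l : 'I_p) : P :=
  \sum_(i in xs l) (multiplicity i)%:R^-1 *: 'X_(iX p i) ^+ 2
  + p%:R^-1 *: 'X_(iX0 n p) ^+ 2 + 'X_(iW n l) ^+ 2 - 1.

Definition hlast : P := \sum_(l < p) 'X_(iW n l) ^+ 2 - p%:R + 1.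

(* h'_1, ..., h'_p, h'_(p+1) *)
Definition hprime (j : 'I_p.+1) : P :=
  if unlift ord_max j is Some l then hl l else hlast.

Definition constraints : seq P :=
  'X_(iX0 n p) :: [seq hprime j | j : 'I_p.+1]
  ++ [seq 1 - 'X_i ^+ 2 | i : 'I_(n.+1 + p)].

(* The decision variable gamma ranges over all coefficients of x_0 ^ d, so the
   monomials of the objective constraint are those occurring for some gamma. *)
Definition csp_adj (f : {mpoly R[n]}) (i j : 'I_(n.+1 + p)) : Prop :=
  i != j /\
  ((exists (gamma : R) (m : 'X_{1..n.+1 + p}),
      [/\ m \in msupp (homogenization f - gamma *: 'X_(iX0 n p) ^+ mpdeg f),
          m i != 0%N & m j != 0%N])
   \/ exists g, [/\ g \in constraints, occurs i g & occurs j g]).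

End Problem.

(* Main.v *)
Require Import Defs.
From HB Require Import structures.
From mathcomp Require Import all_boot all_order all_algebra.
From mathcomp Require Import mpoly.
From mathcomp Require Import reals.
From mathcomp Require Import ring lra zify.
From mathcomp Require boolp classical_sets topology normedtype derive.

Set Implicit Arguments.
Unset Strict Implicit.
Unset Printing Implicit Defensive.

Import Order.TTheory GRing.Theory Num.Theory.
Local Open Scope ring_scope.

(** The equality constraints exclude the points with [x_0 = x_1 = ... = x_n = 0]
([constraints_nonzero]), and away from these the homogenization [F] of [f] is
positive: off the hyperplane at infinity because [f > 0] and the degree is
even, on it because the top form is positive definite
([homogenization_gt0]).  By compactness of the box [-1, 1]^N there is a
constant [lam] such that [F + lam * \sum h'_j ^+ 2] is bounded below by a
positive constant on the whole box ([penalty_on_box]).  The added squares are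
of the form [tau * h'_j] up to sign, and the variables of each monomial of [F]
form a clique; so it remains to represent a sum of polynomials [g l], each in
the variables of one maximal clique [U l], that is positive on the box, by
sums of squares and the generators [1 - u_i ^+ 2] alone
([sparse_box_positivstellensatz]).

Bernstein polynomials reduce this to a finite problem.  In the coordinates
[y_i = (1 + u_i) / 2], a polynomial [g] is, for every large [m], exactly the
combination of the products of the basis polynomials
['C(m, k) * y ^+ k * (1 - y) ^+ (m - k)] whose coefficient at the node [k] is
close to the value of [g] at the corresponding grid point
([bernstein_op_node_value], [node_value_approx]).  Two facts finish the
argument.

- The coefficients can be made nonnegative clique by clique.  The sum of the
  coefficients of all [g l] is a positive function on a finite grid, and a
  nonnegative sum of functions, each depending on the coordinates of one
  clique, can be rewritten as such a sum with nonnegative terms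
  ([nonneg_clique_sum_in]).  This is variable elimination along the vertices of
  a chordal graph: by Dirac's lemma ([simplicial_exists]) there always is a
  vertex whose neighbours form a clique, and one minimises over its
  coordinate.  As the grid is finite, the partial minimum is an ordinary
  function on the grid and need not be approximated.

- Products of the [y_i] and [1 - y_i] are in the quadratic module generated by
  the [1 - u_i ^+ 2], up to an arbitrarily small positive constant
  ([unit_intervalM]).  The reason is F. Riesz's proof that products of
  commuting positive operators are positive: iterating [x |-> x - x ^+ 2]
  writes an element [a] with [0 <= a <= 1] as a sum of squares plus a
  remainder that tends to 0, with certificates in the module at each step. *)

(** * Simplicial vertices of chordal graphs *)

Section Chordal.
Variables (T : finType) (G : rel T).
Hypotheses (G_sym : ssrbool.symmetric G) (G_irr : irreflexive G).
Hypothesis G_chordal : chordal G.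

Definition simplicial (W : {set T}) (s : T) : Prop :=
  forall x y, x \in W -> y \in W -> G s x -> G s y -> x != y -> G x y.

Lemma next_consecutive (x0 x y : T) (s1 s2 : seq T) :
    uniq (x0 :: s1 ++ x :: y :: s2) ->
  next (x0 :: s1 ++ x :: y :: s2) x = y.
Proof.
rewrite cons_uniq => /andP[x0s]; rewrite cat_uniq => /and3P[_ /norP[xs1 _] _].
have x0x : x0 != x.
  by apply: contraNneq x0s => ->; rewrite mem_cat inE eqxx orbT.
rewrite next_nth inE mem_cat inE eqxx !orbT /= (negPf x0x) index_cat (negPf xs1).
by rewrite /= eqxx addn0 -cat_rcons nth_cat size_rcons ltnn subnn.
Qed.

(** If [s] and [t] were not adjacent, a shortest such path together with [a]
would be a cycle of length at least 4.  Its only possible chords join two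
vertices of the path, because the inner vertices are not adjacent to [a], and
such a chord shortens the path. *)
Lemma chordal_no_detour (a s t : T) (q : seq T) :
    G a s -> G a t -> s != t -> ~~ G s t -> path G s q -> last s q = t ->
    (forall x, x \in q -> x != t -> (x != a) && ~~ G a x) ->
  False.
Proof.
move=> Gas Gat st nGst.
have [k] := ubnP (size q); elim: k => // k IHk in q *.
rewrite ltnS => + Gq; case/shortenP: Gq => p Gp Up subp size_q lastp farq.
have size_p : (size p <= k)%N.
  apply: leq_trans size_q; apply: uniq_leq_size subp.
  by case/andP: Up.
have farp x : x \in p -> x != t -> (x != a) && ~~ G a x by move/subp/farq.
have {farq subp q size_q} a_t : a != t.
  by apply: contraTneq Gat => <-; rewrite G_irr.
have a_s : a != s by apply: contraTneq Gas => <-; rewrite G_irr.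
have ap : a \notin p.
  by apply/negP => /farp/(_ a_t); rewrite eqxx.
have Uc : uniq (a :: s :: p) by rewrite cons_uniq Up inE negb_or a_s ap.
have Cc : ucycle G (a :: s :: p).
  by rewrite /ucycle /ucycleb Uc /= rcons_path lastp Gas Gp G_sym Gat.
have size_c : (3 < size (a :: s :: p))%N.
  move: lastp Gp; case: (p) => [|x [|y p']] //=.
    by move=> e; rewrite e eqxx in st.
  by move=> -> /andP[]; rewrite (negPf nGst).
have nbr_a y : y \in s :: p -> G a y -> (y == s) || (y == t).
  rewrite inE => /orP[-> //|yp Gay]; case: (eqVneq y t) => [->|yt].
    by rewrite orbT.
  by have := farp y yp yt; rewrite Gay andbF.
have next_t : next (a :: s :: p) t = a.
  by rewrite -lastp -[last s p]/(last a (s :: p)) next_nth mem_last index_last ?nth_default.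
have next_a : next (a :: s :: p) a = s by rewrite /= eqxx.
(* A chord between two vertices of the path yields a shorter path. *)
have chord x y : x \in s :: p -> y \in s :: p -> G x y ->
    y != next (a :: s :: p) x -> (index x (s :: p) < index y (s :: p))%N -> False.
  move=> xp yp Gxy ny lt_xy.
  have lt_y := yp; rewrite -index_mem in lt_y.
  have yd : y \in drop (index x (s :: p)).+1 (s :: p).
    have := nth_index a yp.
    rewrite -[X in nth _ _ X](subnKC lt_xy) -nth_drop => <-.
    apply: mem_nth; rewrite size_drop ltn_sub2r //; exact: leq_ltn_trans lt_xy lt_y.
  have Esp := cat_take_drop (index x (s :: p)) (s :: p).
  rewrite (drop_nth a) ?index_mem // nth_index // in Esp.
  move: Esp yd; move: (take _ _) (drop _ _) => p1 p2 Esp yd.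
  case/splitPr: yd Esp => p3 p4 Esp.
  case: p3 Esp => [|z p3] Esp.
    have := ny; rewrite -Esp next_consecutive ?eqxx //; by rewrite Esp.
  case: p1 Esp => [|s' p1] [].
    move=> Exs Ep; move: lastp Gp; rewrite -Ep /= last_cat cat_path /= => lastp Gp.
    apply: (IHk (y :: p4)) => //=.
    - by move: size_p; rewrite -Ep /= size_cat /= => /(leq_trans _);
      apply; rewrite !ltnS addnS ltnS leq_addl.
    - by rewrite -Exs Gxy; case/and4P: Gp.
    - by move=> v vp; apply: farp; rewrite -Ep inE mem_cat vp !orbT.
  move=> _ Ep; apply: (IHk (p1 ++ x :: y :: p4)) => //=.
  - move: size_p; rewrite -Ep !size_cat /= size_cat /=; apply: leq_trans.
    by rewrite -addnS leq_add2l !ltnS addnS ltnS leq_addl.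
  - move: Gp; rewrite -Ep !cat_path /= cat_path /= => /and5P[-> -> _ _ /andP[_ ->]].
    by rewrite Gxy.
  - by move: lastp; rewrite -Ep !last_cat /= last_cat.
  - move=> v; rewrite mem_cat !inE => vp; apply: farp.
    by rewrite -Ep mem_cat !inE mem_cat inE; case/or4P: vp => ->; rewrite ?orbT.
have [x [y [xc yc Gxy nx ny]]] := G_chordal Cc size_c.
wlog lt_xy : x y xc yc Gxy nx ny / (index x (a :: s :: p) < index y (a :: s :: p))%N.
  move=> W; case: (ltngtP (index x (a :: s :: p)) (index y (a :: s :: p))) => I.
  - exact: (W x y).
  - by apply: (W y x) => //; rewrite G_sym.
  - by move/index_inj: I Gxy => ->; rewrite ?G_irr.
move: xc yc lt_xy; rewrite [x \in _]inE [y \in _]inE => /orP[/eqP xa|xp] /orP[/eqP ya|yp].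
- by rewrite xa ya G_irr in Gxy.
- move=> _; rewrite xa in Gxy nx ny; case/orP: (nbr_a y yp Gxy) => /eqP E.
    by rewrite E next_a eqxx in nx.
  by rewrite E next_t eqxx in ny.
- by rewrite ya /= eqxx.
- rewrite -cat1s !index_cat !mem_seq1 => lt_xy; apply: (chord x y) => //.
  have neq_a v : v \in s :: p -> (v == a) = false.
    by move=> vp; apply: contraTF vp => /eqP->; case/andP: Uc.
  by move: lt_xy; rewrite !neq_a // ltn_add2l.
Qed.


(** The stronger form of Dirac's lemma that makes the induction work.  Take the
component [C] of [b] among the vertices not adjacent to [a], and the set [S] of
neighbours of [a] attached to [C].  Joining two vertices of [S] through [C]
shows that [S] is a clique.  A vertex of [C] has all its neighbours in
[C :|: S], so it is enough to find in [C] a vertex that is simplicial in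
[C :|: S]; the induction hypothesis applied to that smaller set provides it,
because a vertex that avoids the neighbourhood of a suitable point of
[C :|: S] cannot lie in the clique [S].  If every point is adjacent to all of
[C :|: S], then [b] itself will do. *)
Lemma simplicial_avoiding (W : {set T}) (a b : T) :
    a \in W -> b \in W -> b != a -> ~~ G a b ->
  exists s, [/\ s \in W, s != a, ~~ G a s & simplicial W s].
Proof.
have [k] := ubnP #|W|; elim: k => // k IHk in W a b *.
rewrite ltnS => sizeW aW bW ba nGab.
pose far := [set x in W | (x != a) && ~~ G a x].
pose r := [rel x y | [&& G x y, x \in far & y \in far]].
have r_sym : ssrbool.symmetric r by move=> x y /=; rewrite G_sym [(x \in _) && _]andbC.
pose C := [set x in far | connect r b x].
pose S := [set x in W | G a x & [exists c in C, G x c]].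
pose H := C :|: S.
have bfar : b \in far by rewrite inE bW ba.
have bC : b \in C by rewrite inE bfar connect0.
have farC c : c \in C -> [/\ c \in W, c != a & ~~ G a c].
  by rewrite inE => /andP[]; rewrite inE => /and3P[].
have closed_C c x : c \in C -> x \in W -> G c x -> x \in H.
  move=> cC xW Gcx; have [_ ca nGac] := farC c cC.
  rewrite !inE; case: (boolP (G a x)) => Gax.
    rewrite xW /= orbC; apply/orP; left; apply/exists_inP; exists c => //.
    by rewrite G_sym.
  have xa : x != a by apply: contraNneq nGac => <-; rewrite G_sym.
  rewrite xW xa /=; move: cC; rewrite inE => /andP[cfar /connect_trans->] //.
  by apply: connect1; rewrite /= Gcx cfar !inE xW xa Gax.
have S_clique s t : s \in S -> t \in S -> s != t -> G s t.
  rewrite !inE => /and3P[_ Gas /exists_inP[c cC Gsc]] /and3P[_ Gat /exists_inP[d dC Gtd]] st.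
  apply/negPn/negP => nGst.
  have: connect r c d.
    move: cC dC; rewrite !inE => /andP[_ bc] /andP[_ bd]; apply: connect_trans bd.
    by rewrite (sym_connect_sym r_sym).
  case/connectP => w rw dw.
  have Gw : path G c w by apply: sub_path rw => x y /and3P[].
  have far_w x : x \in c :: w -> x \in far.
    rewrite inE => /predU1P[->|]; first by move: cC; rewrite inE => /andP[].
    elim: (w) (c) rw => //= y v IHv z /andP[/and3P[_ _ yfar] rv].
    by rewrite inE => /predU1P[->//|]; apply: IHv rv.
  apply: (@chordal_no_detour a s t (c :: rcons w t)) => //.
  - by rewrite /= Gsc rcons_path Gw -dw G_sym.
  - by rewrite /= last_rcons.
  - move=> x; rewrite -rcons_cons mem_rcons inE => /predU1P[->|/far_w]; first by rewrite eqxx.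
    by rewrite inE => /and3P[_ -> ->].
have lt_H : (#|H| < k)%N.
  apply: leq_trans sizeW; apply: proper_card; apply/properP; split.
    by apply/subsetP => x; rewrite !inE => /orP[/andP[/andP[]]|/and3P[]].
  by exists a; rewrite // !inE eqxx G_irr /= andbF.
have lift s : s \in C -> simplicial H s ->
    exists s, [/\ s \in W, s != a, ~~ G a s & simplicial W s].
  move=> sC simp; have [sW sa nGas] := farC s sC.
  exists s; split=> // x y xW yW Gsx Gsy; apply: simp => //; exact: (closed_C s).
have nbrH c s : c \in H -> s \in H -> c \notin C -> s \notin C -> s != c -> G c s.
  move=> cH sH cC sC; rewrite eq_sym; apply: S_clique.
    by move: cH; rewrite in_setU (negPf cC).
  by move: sH; rewrite in_setU (negPf sC).
(* The vertex to be avoided in H is taken in S if possible: then S, a clique,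
   is avoided altogether.  Otherwise every vertex of S is adjacent to all of H,
   and avoiding a vertex of C also avoids S. *)
case: (boolP [exists x in S, exists y in H, (y != x) && ~~ G x y]).
  case/exists_inP => x xS /exists_inP[y yH /andP[yx nGxy]].
  have xH : x \in H by rewrite in_setU xS orbT.
  have [s [sH sx nGxs simp]] := IHk _ _ _ lt_H xH yH yx nGxy.
  apply: (lift s) => //; move: sH; rewrite in_setU => /orP[//|sS].
  by case/negP: nGxs; apply: S_clique; rewrite // eq_sym.
rewrite negb_exists_in => /forall_inP univS.
have univ x y : x \in S -> y \in H -> y != x -> G x y.
  move=> xS yH yx; have := univS x xS; rewrite negb_exists_in => /forall_inP/(_ y yH).
  by rewrite yx negbK.
case: (boolP [exists x in C, exists y in H, (y != x) && ~~ G x y]).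
  case/exists_inP => x xC /exists_inP[y yH /andP[yx nGxy]].
  have xH : x \in H by rewrite in_setU xC.
  have [s [sH sx nGxs simp]] := IHk _ _ _ lt_H xH yH yx nGxy.
  apply: (lift s) => //; move: sH; rewrite in_setU => /orP[//|sS].
  by case/negP: nGxs; rewrite G_sym; apply: univ; rewrite // eq_sym.
rewrite negb_exists_in => /forall_inP univC.
apply: (lift b) => // x y xH yH _ _ xy.
move: xH; rewrite in_setU => /orP[xC|xS]; last by apply: univ; rewrite // eq_sym.
have := univC x xC; rewrite negb_exists_in => /forall_inP/(_ y yH).
by rewrite eq_sym xy negbK.
Qed.

Lemma simplicial_exists (W : {set T}) :
  W != set0 -> exists2 s, s \in W & simplicial W s.
Proof.
case/set0Pn => a aW.
case: (boolP [exists x in W, exists y in W, (y != x) && ~~ G x y]).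
  case/exists_inP => x xW /exists_inP[y yW /andP[yx nGxy]].
  by have [s [sW _ _ simp]] := simplicial_avoiding xW yW yx nGxy; exists s.
rewrite negb_exists_in => /forall_inP complete; exists a => // x y xW yW _ _ xy.
have := complete x xW; rewrite negb_exists_in => /forall_inP/(_ y yW).
by rewrite eq_sym xy negbK.
Qed.

End Chordal.

(** * Nonnegative sums of functions on cliques *)

Section Dependence.
Variables (R : realDomainType) (T D : finType).
Implicit Types (A B : {set T}) (k : {ffun T -> D}) (g : {ffun T -> D} -> R).

Definition depends_on A g := forall k k', {in A, k =1 k'} -> g k = g k'.

Lemma depends_onS A B g : A \subset B -> depends_on A g -> depends_on B g.
Proof. by move=> /subsetP AB gA k k' kk'; apply: gA => i /AB/kk'. Qed.

Definition update k v d : {ffun T -> D} := [ffun i => if i == v then d else k i].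

Lemma update_id k v : update k v (k v) = k.
Proof. by apply/ffunP => i; rewrite ffunE; case: eqP => // ->. Qed.

Lemma depends_on_update A g v d :
  depends_on A g -> depends_on (A :\ v) (fun k => g (update k v d)).
Proof.
move=> gA k k' kk'; apply: gA => i iA; rewrite !ffunE; case: eqP => // /eqP iv.
by apply: kk'; rewrite !inE iv.
Qed.

End Dependence.

Section Decomposition.
Variables (R : realDomainType) (T D : finType) (d0 : D) (G : rel T).
Hypotheses (G_sym : ssrbool.symmetric G) (G_irr : irreflexive G).
Hypothesis G_chordal : chordal G.
Variables (q : nat) (U : 'I_q -> {set T}).
Hypothesis U_clique : forall l, cliqueb G (U l).
Hypothesis U_cover : forall A, cliqueb G A -> exists l, A \subset U l.

(** On a finite grid no approximation is needed to make the summands nonnegative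
one by one.  A simplicial vertex [v] of [W] has all its neighbours in a single
clique [U l0], so the sum [h] of the terms that involve [v] is a function on
[U l0].  Its minimum [low] over the [v]-coordinate no longer involves [v]:
[h - low] is a nonnegative term for [l0], and [low] joins the remaining terms,
whose sum is still nonnegative.  Then [v] is removed from [W]. *)
Lemma nonneg_clique_sum_in (W : {set T}) (g : 'I_q -> {ffun T -> D} -> R) :
    (forall l, depends_on (U l :&: W) (g l)) ->
    (forall k, 0 <= \sum_l g l k) ->
  exists g' : 'I_q -> {ffun T -> D} -> R,
    [/\ forall l, depends_on (U l :&: W) (g' l),
        forall l k, 0 <= g' l k &
        forall k, \sum_l g' l k = \sum_l g l k].
Proof.
have [m] := ubnP #|W|; elim: m => // m IHm in W g *; rewrite ltnS => sizeW gW g_ge0.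
have [W0 | W_neq0] := eqVneq W set0.
  have [l0 _] : exists l, set0 \subset U l.
    by apply: U_cover; apply/forall_inP => x; rewrite inE.
  exists (fun l k => if l == l0 then \sum_j g j k else 0); split.
  - move=> l k k' _; case: eqP => // _; apply: eq_bigr => j _.
    by apply: gW => i; rewrite W0 setI0 inE.
  - by move=> l k; case: eqP.
  - by move=> k; rewrite -big_mkcond big_pred1_eq.
have [v vW v_simp] := simplicial_exists G_sym G_irr G_chordal W_neq0.
have [l0 nbr_l0] : exists l, v |: [set x in W | G v x] \subset U l.
  apply: U_cover; apply/forall_inP => x; rewrite !inE => /predU1P[->|/andP[xW vx]];
    apply/forall_inP => y; rewrite !inE => /predU1P[->|/andP[yW vy]]; apply/implyP => xy.
  - by rewrite eqxx in xy.
  - by [].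
  - by rewrite G_sym.
  - exact: v_simp.
have vl0 : v \in U l0 by apply: (subsetP nbr_l0); rewrite !inE eqxx.
have U_l0 l : v \in U l -> U l :&: W \subset U l0 :&: W.
  move=> vl; apply/subsetP => x /setIP[xl xW]; rewrite inE xW andbT.
  apply: (subsetP nbr_l0); rewrite !inE xW; case: eqVneq => //= xv.
  by move/forall_inP/(_ v vl)/forall_inP/(_ x xl)/implyP: (U_clique l); rewrite eq_sym; apply.
pose h k := \sum_(l | v \in U l) g l k.
pose low k := \big[Num.min/h (update k v d0)]_d h (update k v d).
have hW : depends_on (U l0 :&: W) h.
  move=> k k' kk'; apply: eq_bigr => l vl; apply: (gW l).
  by move=> i /(subsetP (U_l0 l vl))/kk'.
have lowW : depends_on (U l0 :&: (W :\ v)) low.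
  move=> k k' kk'; have E d : h (update k v d) = h (update k' v d).
    by apply: (depends_on_update d hW) => i; rewrite -setIDA => /kk'.
  by rewrite /low E; apply: eq_bigr => d _; rewrite E.
have low_le k : low k <= h k.
  by rewrite -{2}(update_id k v); apply: bigmin_le_cond.
have low_eq k : exists d, low k = h (update k v d).
  rewrite /low; elim/big_ind: _ => [|x y [d ->] [e ->]|d _].
  - by exists d0.
  - by rewrite /Num.min; case: ifP => _; [exists d|exists e].
  - by exists d.
pose g1 l k := if l == l0 then low k else if v \in U l then 0 else g l k.
have sum_g1 k : \sum_l g1 l k = low k + \sum_(l | v \notin U l) g l k.
  rewrite (bigD1 l0) //= /g1 eqxx; congr (_ + _).
  rewrite big_mkcond [RHS]big_mkcond; apply: eq_bigr => l _.
  by case: (eqVneq l l0) => [->|_] /=; [rewrite vl0|case: (v \in U l)].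
have sum_g k : \sum_l g l k = h k + \sum_(l | v \notin U l) g l k.
  by rewrite (bigID (fun l => v \in U l)).
have g1W l : depends_on (U l :&: (W :\ v)) (g1 l).
  rewrite /g1; case: (eqVneq l l0) => [->|_]; first exact: lowW.
  case: (boolP (v \in U l)) => vl; first by [].
  apply: depends_onS (gW l); apply/subsetP => i; rewrite !inE => /andP[il ->].
  by rewrite il andbT; apply: contraNneq vl => <-.
have g1_ge0 k : 0 <= \sum_l g1 l k.
  have [d low_d] := low_eq k; rewrite sum_g1 low_d.
  have := g_ge0 (update k v d); rewrite sum_g; congr (_ <= _ + _).
  apply: eq_bigr => l vl; apply: (gW l) => i; rewrite ffunE inE => /andP[il _].
  by case: eqP => // iv; rewrite -iv il in vl.
have sizeWv : (#|W :\ v| < m)%N.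
  by apply: leq_trans sizeW; rewrite [X in (_ < X)%N](cardsD1 v) vW.
have [g2 [g2W g2_ge0 sum_g2]] := IHm _ _ sizeWv g1W g1_ge0.
exists (fun l k => g2 l k + (if l == l0 then h k - low k else 0)); split.
- move=> l k k' kk'; congr (_ + _).
    by apply: (g2W l) => i; rewrite setIDA inE => /andP[_ /kk'].
  case: (eqVneq l l0) kk' => // -> kk'; congr (_ - _); first exact: hW.
  by apply: lowW => i; rewrite setIDA inE => /andP[_ /kk'].
- by move=> l k; rewrite addr_ge0 //; case: eqP => // _; rewrite subr_ge0.
- move=> k; rewrite big_split /= sum_g2 -big_mkcond big_pred1_eq sum_g1 sum_g.
  by rewrite addrC addrA subrK.
Qed.

End Decomposition.

(** * Products in archimedean quadratic modules *)

Section QuadraticModule.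
Variables (R : archiRcfType) (A : comNzRingType) (iota : {rmorphism R -> A}).
Variable S : A -> Prop.

(** Quadratic modules are taken in a subring [S] of an [R]-algebra [A], so that
the modules attached to different cliques live in one polynomial ring. *)
Record subalgebra := Subalgebra {
  subalgC : forall c, S (iota c);
  subalgD : forall a b, S a -> S b -> S (a + b);
  subalgM : forall a b, S a -> S b -> S (a * b) }.

Record quadratic_module (M : A -> Prop) := QuadraticModule {
  qm_sub : forall a, M a -> S a;
  qm1 : M 1;
  qmD : forall a b, M a -> M b -> M (a + b);
  qm_sqr : forall h a, S h -> M a -> M (h ^+ 2 * a) }.

Definition archimedean_qm (M : A -> Prop) := forall h, S h -> exists c, M (iota c - h ^+ 2).

Definition qm_closure (M : A -> Prop) a := forall e, 0 < e -> M (a + iota e).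

Hypothesis S_alg : subalgebra.

Lemma subalgN a : S a -> S (- a).
Proof. by move=> Sa; rewrite -mulN1r -(rmorphN1 iota); apply: subalgM (subalgC _ _) Sa. Qed.

Lemma subalgB a b : S a -> S b -> S (a - b).
Proof. by move=> Sa Sb; apply: subalgD (subalgN Sb). Qed.

Section Fixed.
Variable M : A -> Prop.
Hypothesis qM : quadratic_module M.

Lemma qmZ c a : 0 <= c -> M a -> M (iota c * a).
Proof.
move=> c_ge0 Ma; rewrite -(sqr_sqrtr c_ge0) rmorphXn.
exact: (qm_sqr qM (subalgC S_alg _) Ma).
Qed.

Lemma qmC c : 0 <= c -> M (iota c).
Proof. by move=> c_ge0; rewrite -[iota c]mulr1; apply: qmZ (qm1 qM). Qed.

Lemma qm_sqr1 h : S h -> M (h ^+ 2).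
Proof. by move=> Sh; rewrite -[_ ^+ 2]mulr1; apply: (qm_sqr qM Sh (qm1 qM)). Qed.

(** This is the identity [a * b * (a + b) = a ^+ 2 * b + b ^+ 2 * a]. *)
Lemma qmM_sumC a b c : 0 < c -> a + b = iota c -> M a -> M b -> M (a * b).
Proof.
move=> c_gt0 ab Ma Mb; have Sa := qm_sub qM Ma; have Sb := qm_sub qM Mb.
have -> : a * b = iota c^-1 * (a ^+ 2 * b + b ^+ 2 * a).
  have -> : a ^+ 2 * b + b ^+ 2 * a = iota c * (a * b) by rewrite -ab; ring.
  by rewrite mulrA -rmorphM mulVf ?gt_eqF // rmorph1 mul1r.
apply: qmZ; first by rewrite invr_ge0 ltW.
by apply: (qmD qM); apply: (qm_sqr qM).
Qed.

Lemma qm_1BX2 b : M b -> M (1 - b) -> M (1 - b ^+ 2).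
Proof.
move=> Mb Mb'; have -> : 1 - b ^+ 2 = (1 - b) + b * (1 - b) by ring.
apply: (qmD qM) => //; apply: (@qmM_sumC _ _ 1) => //.
by rewrite addrC subrK rmorph1.
Qed.

(** F. Riesz's expansion of an element [a] of the unit interval as a sum of
squares: consecutive terms differ by a square, so that
[a = \sum_(j < k) riesz a j ^+ 2 + riesz a k], and [riesz a k] tends to 0. *)
Definition riesz (a : A) k := iter k (fun x => x - x ^+ 2) a.

Lemma riesz_in a k : M a -> M (1 - a) -> M (riesz a k) /\ M (1 - riesz a k).
Proof.
move=> Ma Ma'; elim: k => //= k [Mk Mk'].
have Sk := qm_sub qM Mk; split.
  rewrite (_ : _ - _ = riesz a k * (1 - riesz a k)); last by ring.
  by apply: (@qmM_sumC _ _ 1); rewrite // addrC subrK rmorph1.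
by rewrite opprB addrCA addrC; apply: (qmD qM) => //; apply: qm_sqr1.
Qed.

(** The sequence decreases and the squares of its terms add up to at most [1],
hence [riesz a k ^+ 2 <= 1 / k] in the sense of [M]. *)
Lemma riesz_small a k : M a -> M (1 - a) -> M (1 - k%:R * riesz a k ^+ 2).
Proof.
move=> Ma Ma'.
have Mdiff : M (a - riesz a k - k%:R * riesz a k ^+ 2).
  elim: k => [|k IHk] /=.
    have -> : a - a - 0%:R * a ^+ 2 = iota 0 by rewrite rmorph0; ring.
    exact: qmC.
  set x := riesz a k in IHk *; have [Mx _] := riesz_in k Ma Ma'.
  have [My _] := riesz_in k.+1 Ma Ma'; rewrite /= -/x in Mx My.
  have Sx := qm_sub qM Mx.
  rewrite (_ : _ - _ = (a - x - k%:R * x ^+ 2)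
     + iota k.+1%:R * (x ^+ 2 * (x + (x - x ^+ 2)))).
    apply: (qmD qM) => //; apply: qmZ; first exact: ler0n.
    by apply: (qm_sqr qM) => //; apply: (qmD qM).
  by rewrite rmorph_nat -natr1; ring.
have [Mk _] := riesz_in k Ma Ma'.
rewrite (_ : 1 - _ = (1 - a) + riesz a k
                     + (a - riesz a k - k%:R * riesz a k ^+ 2)); last by ring.
by apply: (qmD qM) => //; apply: (qmD qM).
Qed.

Lemma riesz_mul a b k : M a -> M (1 - a) -> M b -> M (a * b - riesz a k * b).
Proof.
move=> Ma Ma' Mb; elim: k => [|k IHk] /=.
  by rewrite subrr -(rmorph0 iota); apply: qmC.
have [Mk _] := riesz_in k Ma Ma'.
rewrite (_ : _ - _ = (a * b - riesz a k * b) + riesz a k ^+ 2 * b); last by ring.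
by apply: (qmD qM) => //; apply: (qm_sqr qM) => //; apply: (qm_sub qM Mk).
Qed.

(** A quadratic module need not be closed under products, but the product of
two elements of its unit interval is in it up to any positive constant: in
[a * b], replace [a] by a sum of squares, and absorb the small remainder
[x * b] by completing a square. *)
Lemma qm_closureM a b : M a -> M (1 - a) -> M b -> M (1 - b) -> qm_closure M (a * b).
Proof.
move=> Ma Ma' Mb Mb' e e_gt0.
have [n le_n] : exists n, e^-1 <= n.+1%:R.
  have e_ge0 : 0 <= e^-1 by rewrite invr_ge0 ltW.
  exists (Num.bound e^-1); apply: (le_trans (ltW (archi_boundP e_ge0))).
  by rewrite ler_nat.
(* t controls the error: t^-1 <= e, and t ^ 2 steps of the expansion are used. *)
pose t : R := n.+1%:R; have t_gt0 : 0 < t by rewrite ltr0n.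
have te : t^-1 <= e by rewrite -(invrK e) lef_pV2 ?posrE ?invr_gt0.
set x := riesz a (n.+1 * n.+1).
have [Mx _] := riesz_in (n.+1 * n.+1) Ma Ma'; rewrite -/x in Mx.
have Sx := qm_sub qM Mx; have Sb := qm_sub qM Mb.
have Msmall := riesz_small (n.+1 * n.+1) Ma Ma'; rewrite -/x in Msmall.
pose u := iota t; pose v := iota t^-1.
have uv : u * v = 1 by rewrite -rmorphM divff ?gt_eqF // rmorph1.
have uE : (n.+1 * n.+1)%:R = u * u :> A by rewrite natrM /u rmorph_nat.
have Mv : M (x * b + v).
  have -> : x * b + v = iota (2%:R^-1 * t) * (x + v * b) ^+ 2
      + iota (2%:R^-1 * t^-1) * (1 - (n.+1 * n.+1)%:R * x ^+ 2)
      + iota (2%:R^-1 * t^-1) * (1 - b ^+ 2).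
    rewrite !rmorphM -/u -/v uE.
    have h2 : iota 2%:R^-1 * 2%:R = 1.
      by rewrite -(rmorph_nat iota) -rmorphM mulVf ?pnatr_eq0 // rmorph1.
    set z := iota 2%:R^-1 in h2 *.
    have e1 : z * u * (x + v * b) ^+ 2
        = z * u * x ^+ 2 + z * 2%:R * (u * v) * x * b + z * (u * v) * v * b ^+ 2 by ring.
    have e2 : z * v * (1 - u * u * x ^+ 2) = z * v - z * (u * v) * u * x ^+ 2 by ring.
    rewrite e1 e2 uv h2.
    have vE : v = z * 2%:R * v by rewrite h2 mul1r.
    rewrite {1}vE; ring.
  have le_half s : 0 < s -> 0 <= 2%:R^-1 * s :> R.
    by move=> s_gt0; rewrite mulr_ge0 ?invr_ge0 ?ler0n ?ltW.
  apply: (qmD qM); first apply: (qmD qM).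
  - apply: qmZ; first exact: le_half.
    apply: qm_sqr1; apply: subalgD => //; apply: subalgM => //; exact: subalgC.
  - by apply: qmZ; rewrite // le_half // invr_gt0.
  - by apply: qmZ; rewrite ?le_half ?invr_gt0 //; apply: qm_1BX2.
have -> : a * b + iota e = (a * b - x * b) + (x * b + v) + iota (e - t^-1).
  by rewrite rmorphB -/v; ring.
apply: (qmD qM); last by apply: qmC; rewrite subr_ge0.
by apply: (qmD qM) => //; apply: riesz_mul.
Qed.

Lemma qm_in_closure a : M a -> qm_closure M a.
Proof. by move=> Ma e e_gt0; apply: (qmD qM) => //; apply: qmC; apply: ltW. Qed.

End Fixed.

Section Closure.
Variable M : A -> Prop.
Hypotheses (qM : quadratic_module M) (archM : archimedean_qm M).

Lemma qm_closure_qm : quadratic_module (qm_closure M).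
Proof.
split.
- move=> a /(_ 1 ltr01) /(qm_sub qM) Sa; rewrite -[a](addrK (iota 1)).
  by apply: subalgB => //; apply: subalgC.
- by apply: (qm_in_closure qM); apply: qm1.
- move=> a b Ma Mb e e_gt0; rewrite {1}(splitr e) rmorphD addrACA.
  by apply: (qmD qM); [apply: Ma | apply: Mb]; rewrite divr_gt0.
- move=> h a Sh Ma e e_gt0; have [c0 Mc0] := archM Sh.
  pose c := `|c0| + 1; have c_gt0 : 0 < c by rewrite ltr_wpDl.
  have Mc : M (iota c - h ^+ 2).
    rewrite (_ : _ - _ = (iota c0 - h ^+ 2) + iota (c - c0)); last by rewrite rmorphB; ring.
    apply: (qmD qM) => //; apply: (qmC qM); rewrite subr_ge0 /c.
    by rewrite (le_trans (ler_norm _)) // lerDl.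
  have -> : h ^+ 2 * a + iota e
      = h ^+ 2 * (a + iota (e / c)) + iota (e / c) * (iota c - h ^+ 2).
    have -> : iota e = iota (e / c) * iota c by rewrite -rmorphM divfK ?gt_eqF.
    by ring.
  apply: (qmD qM); first by apply: (qm_sqr qM) => //; apply: Ma; apply: divr_gt0.
  by apply: (qmZ qM) => //; apply: ltW; apply: divr_gt0.
Qed.

Lemma qm_closure_idem a : qm_closure (qm_closure M) a -> qm_closure M a.
Proof.
move=> Ma e e_gt0; have e2_gt0 : 0 < e / 2%:R by rewrite divr_gt0.
by rewrite (splitr e) rmorphD addrA; apply: Ma.
Qed.

(** Since [qm_closure M] is again an archimedean quadratic module, equal to its
own closure, its unit interval is closed under products. *)
Definition unit_interval a := qm_closure M a /\ qm_closure M (1 - a).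

Lemma unit_interval1 : unit_interval 1.
Proof.
split; first exact: qm1 qm_closure_qm.
by rewrite subrr -(rmorph0 iota); apply: (qmC qm_closure_qm).
Qed.

Lemma unit_intervalM a b : unit_interval a -> unit_interval b -> unit_interval (a * b).
Proof.
have qC := qm_closure_qm; move=> [Ma Ma'] [Mb Mb']; split.
  exact/qm_closure_idem/(qm_closureM qC).
rewrite (_ : 1 - _ = (1 - a) + a * (1 - b)); last by ring.
apply: (qmD qC) => //; apply/qm_closure_idem/(qm_closureM qC) => //.
by rewrite opprB addrC subrK.
Qed.

Lemma unit_intervalX a k : unit_interval a -> unit_interval (a ^+ k).
Proof.
move=> ua; elim: k => [|k IHk]; first exact: unit_interval1.
by rewrite exprS; apply: unit_intervalM.
Qed.

End Closure.

(** The bounded elements form a subring, so the archimedean property only needs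
to be checked on generators. *)
Definition qm_bounded (M : A -> Prop) h := S h /\ exists c, M (iota c - h ^+ 2).

Lemma qm_boundedC M : quadratic_module M -> forall c, qm_bounded M (iota c).
Proof.
move=> qM c; split; first exact: subalgC.
exists (c ^+ 2); rewrite rmorphXn subrr -(rmorph0 iota); exact: qmC.
Qed.

Lemma qm_boundedD M a b : quadratic_module M -> qm_bounded M a -> qm_bounded M b ->
  qm_bounded M (a + b).
Proof.
move=> qM [Sa [c Mc]] [Sb [d Md]]; split; first exact: subalgD.
exists (2%:R * c + 2%:R * d).
rewrite (_ : _ - _ = iota 2%:R * (iota c - a ^+ 2)
    + iota 2%:R * (iota d - b ^+ 2) + (a - b) ^+ 2).
  apply: (qmD qM); last by apply: (qm_sqr1 qM); apply: subalgB.
  by apply: (qmD qM); apply: (qmZ qM).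
by rewrite rmorphD !rmorphM !rmorph_nat; ring.
Qed.

Lemma qm_boundedM M a b : quadratic_module M -> qm_bounded M a -> qm_bounded M b ->
  qm_bounded M (a * b).
Proof.
move=> qM [Sa [c Mc]] [Sb [d Md]]; split; first exact: subalgM.
have Mc' : M (iota `|c| - a ^+ 2).
  rewrite (_ : _ - _ = (iota c - a ^+ 2) + iota (`|c| - c)); last by rewrite rmorphB; ring.
  by apply: (qmD qM) => //; apply: (qmC qM); rewrite subr_ge0 ler_norm.
exists (`|c| * d).
rewrite (_ : _ - _ = iota `|c| * (iota d - b ^+ 2) + b ^+ 2 * (iota `|c| - a ^+ 2)).
  by apply: (qmD qM); [apply: (qmZ qM) | apply: (qm_sqr qM)].
by rewrite rmorphM; ring.
Qed.

End QuadraticModule.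

(** * Bernstein expansions *)

Section Univariate.
Variable A : comNzRingType.

Definition bernstein (m k : nat) (y : A) : A :=
  'C(m, k)%:R * (y ^+ k * (1 - y) ^+ (m - k)).

(** The factorial moments of the binomial distribution.  They make the Bernstein
expansion of a polynomial exact: [y ^+ j] has the coefficients
[node_power m j k] below, which tend to [(k / m) ^+ j] as [m] grows. *)
Lemma bernstein_ffact m j y :
  \sum_(k < m.+1) (k ^_ j)%:R * bernstein m k y = (m ^_ j)%:R * y ^+ j.
Proof.
elim: j m => [|j IHj] m.
  rewrite ffactn0 mul1r expr0 -[RHS](expr1n _ m) -[X in X ^+ m](subrK y).
  rewrite exprDn; apply: eq_bigr => k _.
  by rewrite ffactn0 mul1r /bernstein mulr_natl [y ^+ k * _]mulrC.
case: m => [|m]; first by rewrite big_ord1 ffact0n !mul0r.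
rewrite big_ord_recl ffact0n mul0r add0r ffactSS natrM exprS.
rewrite mulrACA [_ * y]mulrC -mulrA -IHj mulr_sumr mulr_sumr; apply: eq_bigr => k _.
rewrite /bernstein lift0 ffactSS subSS exprS.
have := mul_bin_diag m.+1 k; move/(congr1 (fun n => n%:R : A)); rewrite /= !natrM => E.
transitivity ((k ^_ j)%:R * (k.+1%:R * 'C(m.+1, k.+1)%:R) * (y * y ^+ k * (1 - y) ^+ (m - k))).
  by ring.
by rewrite -E; ring.
Qed.

End Univariate.

Section Nodes.
Variable R : realFieldType.

Definition node_power (m j k : nat) : R := (k ^_ j)%:R / (m ^_ j)%:R.

Lemma node_power_itv m j k : (k <= m)%N -> (j <= m)%N -> 0 <= node_power m j k <= 1.
Proof.
move=> km jm; rewrite /node_power divr_ge0 //= ler_pdivrMr ?mul1r.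
  by rewrite ler_nat -!bin_ffact leq_mul2r leq_bin2l ?orbT.
by rewrite ltr0n ffact_gt0.
Qed.

(** The factor [(k - i) / (m - i)] of [node_power] differs from [k / m] by at most
[i / m]. *)
Lemma node_power_approx m j k : (0 < m)%N -> (k <= m)%N -> (j <= m)%N ->
  `|node_power m j k - (k%:R / m%:R) ^+ j| <= (j ^ 2)%:R / m%:R.
Proof.
move=> m_gt0 km; elim: j => [|j IHj] jm.
  by rewrite /node_power !ffactn0 divr1 expr0 subrr normr0 divr_ge0.
have {}IHj := IHj (ltnW jm).
have m0 : 0 < m%:R :> R by rewrite ltr0n.
have mj0 : 0 < (m - j)%:R :> R by rewrite ltr0n subn_gt0.
have x01 : 0 <= (k%:R / m%:R : R) <= 1.
  by rewrite divr_ge0 //= ler_pdivrMr // mul1r ler_nat.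
have e01 := node_power_itv km (ltnW jm).
set e := node_power m j k in IHj e01 *; set x := k%:R / m%:R in IHj x01 *.
pose r : R := (k - j)%:R / (m - j)%:R.
have -> : node_power m j.+1 k = e * r.
  by rewrite /e /r /node_power !ffactnSr !natrM mulf_div.
have r_x : `|r - x| <= j%:R / m%:R.
  rewrite /r /x; case: (leqP j k) => jk.
    have -> : (k - j)%:R / (m - j)%:R - k%:R / m%:R
        = - (j%:R / m%:R * ((m - k)%:R / (m - j)%:R)) :> R.
      have := mj0; rewrite !natrB ?(ltnW jm) // => mj0'.
      by field; rewrite !gt_eqF.
    rewrite normrN ger0_norm ?mulr_ge0 ?invr_ge0 //.
    rewrite ler_piMr ?divr_ge0 // ler_pdivrMr // mul1r ler_nat; lia.
  have -> : (k - j)%N = 0%N by lia.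
  rewrite mul0r sub0r normrN ger0_norm ?divr_ge0 //.
  by rewrite ler_pM2r ?invr_gt0 // ler_nat ltnW.
have -> : e * r - x ^+ j.+1 = e * (r - x) + x * (e - x ^+ j) by rewrite exprS; ring.
clearbody e x.
apply: le_trans (ler_normD _ _) _; rewrite !normrM.
case/andP: e01 => e0 e1; case/andP: x01 => x0 x1.
rewrite (ger0_norm e0) (ger0_norm x0).
apply: (@le_trans _ _ (j%:R / m%:R + (j ^ 2)%:R / m%:R)).
  apply: lerD.
    by apply: le_trans r_x; apply: ler_piMl.
  by apply: le_trans IHj; apply: ler_piMl.
by rewrite -mulrDl ler_pM2r ?invr_gt0 // -natrD ler_nat; lia.
Qed.

Lemma prod_approx (T : finType) (a b c : T -> R) :
    (forall i, 0 <= a i <= 1) -> (forall i, 0 <= b i <= 1) ->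
    (forall i, `|a i - b i| <= c i) ->
  `|\prod_i a i - \prod_i b i| <= \sum_i c i.
Proof.
move=> a01 b01 abc.
suff: [/\ 0 <= \prod_i a i <= 1, 0 <= \prod_i b i <= 1 &
          `|\prod_i a i - \prod_i b i| <= \sum_i c i] by case.
elim/big_rec3: _ => [|i z y x _ [/andP[x0 x1] /andP[y0 y1] xyz]].
  by rewrite subrr normr0 lexx ler01.
have /andP[a0 a1] := a01 i; have /andP[b0 b1] := b01 i.
split; rewrite ?mulr_ge0 ?mulr_ile1 //.
have -> : a i * x - b i * y = x * (a i - b i) + b i * (x - y) by ring.
apply: le_trans (ler_normD _ _) _; rewrite !normrM (ger0_norm b0) (ger0_norm x0).
apply: lerD.
  by apply: le_trans (abc i); apply: ler_piMl.
by apply: le_trans xyz; apply: ler_piMl.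
Qed.

End Nodes.

Section Tensor.
Variables (R : archiRcfType) (A : comNzRingType) (iota : {rmorphism R -> A}).
Variables (T : finType) (y : T -> A) (m : nat).
Implicit Types (phi : {ffun T -> 'I_m.+1} -> R) (B : {set T}).

Definition bernstein_op phi : A :=
  \sum_k iota (phi k) * \prod_i bernstein m (k i) (y i).

Lemma sum_bernstein x : \sum_(k < m.+1) bernstein m k x = 1 :> A.
Proof.
have := bernstein_ffact m 0 x; rewrite ffactn0 expr0 mulr1; apply: etrans.
by apply: eq_bigr => k _; rewrite mul1r.
Qed.

Lemma bernstein_op_monomial (al : T -> nat) : (forall i, al i <= m)%N ->
  bernstein_op (fun k => \prod_i node_power R m (al i) (k i)) = \prod_i y i ^+ al i.
Proof.
move=> al_m; rewrite /bernstein_op.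
transitivity (\prod_i \sum_(k < m.+1) iota (node_power R m (al i) k) * bernstein m k (y i)).
  rewrite bigA_distr_bigA; apply: eq_bigr => k _.
  by rewrite rmorph_prod -big_split.
apply: eq_bigr => i _.
have m0 : (m ^_ al i)%:R != 0 :> R by rewrite pnatr_eq0 -lt0n ffact_gt0.
transitivity (iota (m ^_ al i)%:R^-1 * ((m ^_ al i)%:R * y i ^+ al i)); last first.
  by rewrite mulrA -(rmorph_nat iota) -rmorphM mulVf // rmorph1 mul1r.
rewrite -bernstein_ffact mulr_sumr; apply: eq_bigr => k _.
by rewrite /node_power rmorphM rmorph_nat [_ * iota _]mulrC mulrA.
Qed.

Lemma bernstein_op_sum (J : Type) (r : seq J) (P : pred J)
    (psi : J -> {ffun T -> 'I_m.+1} -> R) :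
  bernstein_op (fun k => \sum_(j <- r | P j) psi j k) =
  \sum_(j <- r | P j) bernstein_op (psi j).
Proof.
rewrite /bernstein_op exchange_big; apply: eq_bigr => k _ /=.
by rewrite rmorph_sum mulr_suml.
Qed.

Lemma bernstein_opZ c phi :
  bernstein_op (fun k => c * phi k) = iota c * bernstein_op phi.
Proof.
by rewrite /bernstein_op mulr_sumr; apply: eq_bigr => k _; rewrite rmorphM mulrA.
Qed.

Lemma bernstein_opC c : bernstein_op (fun=> c) = iota c.
Proof.
rewrite /bernstein_op -mulr_sumr.
rewrite -(bigA_distr_bigA (fun i (j : 'I_m.+1) => bernstein m j (y i))) /=.
by rewrite big1 ?mulr1 // => i _; apply: sum_bernstein.
Qed.

Definition restrict B (k : {ffun T -> 'I_m.+1}) : {ffun T -> 'I_m.+1} :=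
  [ffun i => if i \in B then k i else ord0].

(** The basis polynomials in the variables outside [B] add up to [1], so the
Bernstein polynomial of a function on [B] only involves the variables of [B]. *)
Lemma bernstein_op_restrict B phi : depends_on B phi ->
  bernstein_op phi =
  \sum_(k | restrict B k == k) iota (phi k) * \prod_(i in B) bernstein m (k i) (y i).
Proof.
move=> phiB; rewrite /bernstein_op.
have restrictK k : restrict B (restrict B k) = restrict B k.
  by apply/ffunP => i; rewrite !ffunE; case: (i \in B).
rewrite (partition_big (restrict B) (fun k => restrict B k == k)) /=; last first.
  by move=> k _; rewrite restrictK.
apply: eq_bigr => k /eqP kB.
pose Q i : pred 'I_m.+1 := fun j => (i \in B) ==> (j == k i).
transitivity (iota (phi k) * \sum_(f in family Q) \prod_i bernstein m (f i) (y i)).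
  rewrite mulr_sumr; apply: eq_big => f.
    apply/idP/familyP => [/eqP fk i|fQ].
      apply/implyP => iB; rewrite -fk ffunE iB; exact: eqxx.
    apply/eqP/ffunP => i; rewrite -kB ffunE [RHS]ffunE.
    have : (i \in B) ==> (f i == k i) by apply: fQ.
    by case: (i \in B) => //= /eqP.
  move=> /eqP fk; congr (iota _ * _); apply: phiB => i iB.
  by rewrite -fk ffunE iB.
rewrite -(bigA_distr_big_dep _ (fun i (j : 'I_m.+1) => bernstein m j (y i))); congr (_ * _).
rewrite [RHS]big_mkcond; apply: eq_bigr => i _; rewrite /Q.
by case: (i \in B) => /=; [rewrite big_pred1_eq | rewrite sum_bernstein].
Qed.

Variables (S M : A -> Prop).
Hypotheses (S_alg : subalgebra iota S) (qM : quadratic_module S M).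
Hypothesis archM : archimedean_qm iota S M.

Lemma bernstein_op_closure B phi :
    depends_on B phi -> (forall k, 0 <= phi k) ->
    (forall i, i \in B -> unit_interval iota M (y i)) ->
  qm_closure iota M (bernstein_op phi).
Proof.
move=> phiB phi_ge0 yB; rewrite (bernstein_op_restrict phiB).
have qC := qm_closure_qm S_alg qM archM.
elim/big_ind: _ => [|a b|k _].
- by rewrite -(rmorph0 iota); apply: (qmC S_alg qC).
- exact: (qmD qC).
apply: (qmZ S_alg qC) => //.
have bB i : i \in B ->
   bernstein m (k i) (y i) = iota ('C(m, k i)%:R) * (y i ^+ k i * (1 - y i) ^+ (m - k i)).
  by rewrite rmorph_nat.
rewrite (eq_bigr _ bB) big_split -rmorph_prod /=; apply: (qmZ S_alg qC).
  by apply: prodr_ge0 => i _; apply: ler0n.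
suff [] : unit_interval iota M (\prod_(i in B) (y i ^+ k i * (1 - y i) ^+ (m - k i))) by [].
elim/big_ind: _ => [|a b|i iB].
- exact: (unit_interval1 S_alg qM archM).
- exact: (unit_intervalM S_alg qM archM).
apply: (unit_intervalM S_alg qM archM); apply: (unit_intervalX S_alg qM archM).
  exact: yB.
by have [y0 y1] := yB i iB; split; rewrite // opprB addrC subrK.
Qed.

End Tensor.

(** * Polynomials in a subset of the variables *)

Section PolyIn.
Variables (R : realType) (N : nat).
Implicit Types (V : {set 'I_N}) (g h : {mpoly R[N]}).

Lemma poly_inP V g :
  poly_in V g <-> forall m i, m \in msupp g -> i \notin V -> m i = 0%N.
Proof.
split=> [gV m i mg | gV i /hasP[m mg mi]].
  by apply: contraNeq => mi; apply: gV; apply/hasP; exists m.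
by apply: contraNT mi => iV; apply/eqP/gV.
Qed.

Lemma poly_inC V c : poly_in V (c%:MP : {mpoly R[N]}).
Proof.
apply/poly_inP => m i; rewrite msuppC; case: eqP => // _.
by rewrite inE => /eqP->; rewrite mnm0E.
Qed.

Lemma poly_inX V i : i \in V -> poly_in V ('X_i : {mpoly R[N]}).
Proof.
move=> iV; apply/poly_inP => m j; rewrite msuppX inE => /eqP-> jV.
by rewrite mnm1E; case: eqP => // ij; rewrite -ij iV in jV.
Qed.

Lemma poly_inD V g h : poly_in V g -> poly_in V h -> poly_in V (g + h).
Proof.
move=> /poly_inP gV /poly_inP hV; apply/poly_inP => m i /msuppD_le.
by rewrite mem_cat => /orP[/gV|/hV]; apply.
Qed.

Lemma poly_inM V g h : poly_in V g -> poly_in V h -> poly_in V (g * h).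
Proof.
move=> /poly_inP gV /poly_inP hV; apply/poly_inP => m i /msuppM_le.
case/allpairsP => -[m1 m2] /= [m1g m2h ->] iV.
by rewrite mnmDE (gV m1) // (hV m2).
Qed.

Lemma poly_in_subalgebra V : subalgebra (@mpolyC N R) (poly_in V).
Proof. split; [exact: poly_inC | exact: poly_inD | exact: poly_inM]. Qed.

Lemma poly_in_sum V (J : Type) (r : seq J) (P : pred J) (F : J -> {mpoly R[N]}) :
  (forall j, P j -> poly_in V (F j)) -> poly_in V (\sum_(j <- r | P j) F j).
Proof.
by move=> FV; elim/big_ind: _ => //; [rewrite -mpolyC0; apply: poly_inC | apply: poly_inD].
Qed.

Lemma poly_inXn V g k : poly_in V g -> poly_in V (g ^+ k).
Proof.
move=> gV; elim: k => [|k IHk]; first by rewrite expr0 -mpolyC1; apply: poly_inC.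
by rewrite exprS; apply: poly_inM.
Qed.

Lemma poly_inZ V c g : poly_in V g -> poly_in V (c *: g).
Proof. by move=> gV; rewrite -mul_mpolyC; apply: poly_inM => //; apply: poly_inC. Qed.

Lemma poly_inB V g h : poly_in V g -> poly_in V h -> poly_in V (g - h).
Proof.
by move=> gV hV; apply: poly_inD => //; rewrite -scaleN1r; apply: poly_inZ.
Qed.

Lemma poly_in_monomial V (t : 'I_N -> {mpoly R[N]}) (m : 'X_{1..N}) :
    (forall i, i \in V -> poly_in V (t i)) -> (forall i, i \notin V -> m i = 0%N) ->
  poly_in V (\prod_i t i ^+ m i).
Proof.
move=> tV mV; elim/big_ind: _ => [||i _].
- by rewrite -mpolyC1; apply: poly_inC.
- exact: poly_inM.
have [iV|iV] := boolP (i \in V); first by apply: poly_inXn; apply: tV.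
by rewrite mV // expr0 -mpolyC1; apply: poly_inC.
Qed.

Lemma poly_in_comp V g (t : N.-tuple {mpoly R[N]}) :
    poly_in V g -> (forall i, i \in V -> poly_in V (tnth t i)) ->
  poly_in V (g \mPo t).
Proof.
move=> /poly_inP gV tV; rewrite comp_mpolyE big_seq; apply: poly_in_sum => m mg.
by apply/poly_inZ/poly_in_monomial => // i; apply: gV.
Qed.

Lemma poly_in_ind V (Q : {mpoly R[N]} -> Prop) :
    (forall c, Q c%:MP) -> (forall i, i \in V -> Q 'X_i) ->
    (forall g h, Q g -> Q h -> Q (g + h)) -> (forall g h, Q g -> Q h -> Q (g * h)) ->
  forall g, poly_in V g -> Q g.
Proof.
move=> QC QX QD QM g /poly_inP gV; rewrite [g]mpolyE big_seq.
elim/big_ind: _ => [||m mg]; [by rewrite -mpolyC0 | exact: QD |].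
rewrite -mul_mpolyC; apply: (QM) => //; rewrite mpolyXE_id.
elim/big_ind: _ => [||i _]; [by rewrite -mpolyC1 | exact: (QM) |].
have [iV|iV] := boolP (i \in V); last by rewrite (gV m) // expr0 -mpolyC1.
elim: (m i) => [|k IHk]; first by rewrite expr0 -mpolyC1.
by rewrite exprS; apply: (QM) => //; apply: QX.
Qed.

End PolyIn.

(** * The quadratic module of the box *)

Section BoxModule.
Variables (R : realType) (N : nat).
Implicit Types (V : {set 'I_N}) (g h : {mpoly R[N]}).

(** The quadratic module of [R[V]] generated by the [1 - 'X_i ^+ 2]. *)
Definition box_module V g := exists s0 (s : 'I_N -> {mpoly R[N]}),
  [/\ sos_in V s0, forall i, i \in V -> sos_in V (s i) &
      g = s0 + \sum_(i in V) s i * (1 - 'X_i ^+ 2)].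

Lemma sos_in0 V : sos_in V (0 : {mpoly R[N]}).
Proof. by exists [::]; rewrite big_nil. Qed.

Lemma sos_in_sqr V h : poly_in V h -> sos_in V (h ^+ 2).
Proof. by move=> hV; exists [:: h]; rewrite big_seq1; split=> // g; rewrite inE => /eqP->. Qed.

Lemma sos_inD V g h : sos_in V g -> sos_in V h -> sos_in V (g + h).
Proof.
move=> [s [sV ->]] [t [tV ->]]; exists (s ++ t); rewrite big_cat; split=> // u.
by rewrite mem_cat => /orP[/sV|/tV].
Qed.

Lemma sos_in_sqrM V g h : poly_in V h -> sos_in V g -> sos_in V (h ^+ 2 * g).
Proof.
move=> hV [s [sV ->]]; exists [seq h * u | u <- s]; split.
  by move=> _ /mapP[u /sV uV ->]; apply: poly_inM.
by rewrite big_map mulr_sumr; apply: eq_bigr => u _; rewrite exprMn.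
Qed.

Lemma sos_in_poly_in V g : sos_in V g -> poly_in V g.
Proof.
move=> [s [sV ->]]; rewrite big_seq; apply: poly_in_sum => h hs.
by apply: poly_inXn; apply: sV.
Qed.

Lemma box_module_qm V : quadratic_module (poly_in V) (box_module V).
Proof.
split.
- move=> _ [s0 [s [/sos_in_poly_in s0V sV ->]]]; apply: poly_inD => //.
  apply: poly_in_sum => i iV; apply: poly_inM; first exact/sos_in_poly_in/sV.
  apply: poly_inB; first by rewrite -mpolyC1; apply: poly_inC.
  by apply: poly_inXn; apply: poly_inX.
- exists 1, (fun=> 0); split=> [|i _|]; last by rewrite big1 ?addr0 // => i _; rewrite mul0r.
    by rewrite -[1](expr1n _ 2) -mpolyC1; apply/sos_in_sqr/poly_inC.
  exact: sos_in0.
- move=> _ _ [s0 [s [s0V sV ->]]] [t0 [t [t0V tV ->]]].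
  exists (s0 + t0), (fun i => s i + t i); split; first exact: sos_inD.
    by move=> i iV; apply: sos_inD; [apply: sV | apply: tV].
  rewrite addrACA -big_split; congr (_ + _).
  by apply: eq_bigr => i _; rewrite mulrDl.
- move=> h _ hV [s0 [s [s0V sV ->]]].
  exists (h ^+ 2 * s0), (fun i => h ^+ 2 * s i); split; first exact: sos_in_sqrM.
    by move=> i /sV; apply: sos_in_sqrM.
  by rewrite mulrDr mulr_sumr; congr (_ + _); apply: eq_bigr => i _; rewrite mulrA.
Qed.

Lemma box_module_gen V i : i \in V -> box_module V (1 - 'X_i ^+ 2).
Proof.
move=> iV; exists 0, (fun j => (j == i)%:R ^+ 2); split; first exact: sos_in0.
  by move=> j _; apply: sos_in_sqr; rewrite -(rmorph_nat (@mpolyC N R)); apply: poly_inC.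
rewrite add0r (bigD1 i) //= eqxx expr1n mul1r big1 ?addr0 // => j /andP[_ /negPf->].
by rewrite expr0n mul0r.
Qed.

Lemma box_module_archimedean V :
  archimedean_qm (@mpolyC N R) (poly_in V) (box_module V).
Proof.
have qM := box_module_qm V; have S_alg := poly_in_subalgebra R V.
suff bdd h : poly_in V h -> qm_bounded (@mpolyC N R) (poly_in V) (box_module V) h.
  by move=> h /bdd[].
apply: poly_in_ind => [c|i iV|g1 g2|g1 g2].
- exact: (qm_boundedC S_alg qM).
- by split; [apply: poly_inX | exists 1; rewrite rmorph1; apply: box_module_gen].
- exact: (qm_boundedD S_alg qM).
- exact: (qm_boundedM S_alg qM).
Qed.

End BoxModule.

(** * Sparse positivity certificates on the box *)

Section Coordinates.
Variables (R : realType) (N : nat).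
Implicit Types (V : {set 'I_N}) (g : {mpoly R[N]}).

(** The affine coordinates in which the box [-1, 1]^N becomes [0, 1]^N, and the
inverse substitution. *)
Definition unit_coord (i : 'I_N) : {mpoly R[N]} := (2%:R^-1)%:MP * (1 + 'X_i).

Definition to_unit_box : N.-tuple {mpoly R[N]} := [tuple 2%:R * 'X_i - 1 | i < N].

(** Both [unit_coord i] and its complement are a quarter of
[(1 +- 'X_i) ^+ 2 + (1 - 'X_i ^+ 2)]. *)
Lemma unit_coord_interval V i :
  i \in V -> unit_interval (@mpolyC N R) (box_module V) (unit_coord i).
Proof.
move=> iV; have qM := box_module_qm R V; have S_alg := poly_in_subalgebra R V.
have XV : poly_in V ('X_i : {mpoly R[N]}) := poly_inX iV.
have P1 : poly_in V (1 : {mpoly R[N]}) by rewrite -mpolyC1; apply: poly_inC.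
have half : (2%:R^-1)%:MP_[N] * 2%:R = 1 :> {mpoly R[N]}.
  by rewrite -(rmorph_nat (@mpolyC N R)) -rmorphM mulVf ?pnatr_eq0 // rmorph1.
have h0 : 0 <= 2%:R^-1 * 2%:R^-1 :> R by rewrite mulr_ge0 ?invr_ge0.
have inM (h : {mpoly R[N]}) : poly_in V h ->
    box_module V ((2%:R^-1 * 2%:R^-1)%:MP * (h ^+ 2 + (1 - 'X_i ^+ 2))).
  move=> hV; apply: (qmZ S_alg qM) => //; apply: (qmD qM).
    exact: (qm_sqr1 qM).
  exact: box_module_gen.
split; apply: (qm_in_closure S_alg qM).
  have := inM _ (poly_inD P1 XV); congr box_module.
  rewrite /unit_coord mpolyCM; set z := _%:MP in half *.
  have -> : z * z * ((1 + 'X_i) ^+ 2 + (1 - 'X_i ^+ 2)) = z * 2%:R * z * (1 + 'X_i) by ring.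
  by rewrite half mul1r.
have := inM _ (poly_inB P1 XV); congr box_module.
rewrite /unit_coord mpolyCM; set z := _%:MP in half *.
have -> : z * z * ((1 - 'X_i) ^+ 2 + (1 - 'X_i ^+ 2))
    = z * 2%:R * (z * 2%:R - z * (1 + 'X_i)) by ring.
by rewrite half mul1r.
Qed.

Lemma poly_in_to_unit_box V g : poly_in V g -> poly_in V (g \mPo to_unit_box).
Proof.
move=> gV; apply: poly_in_comp => // i iV; rewrite tnth_mktuple.
apply: poly_inB; last by rewrite -mpolyC1; apply: poly_inC.
apply: poly_inM; last exact: poly_inX.
by rewrite -(rmorph_nat (@mpolyC N R)); apply: poly_inC.
Qed.

Lemma unit_coordE g : g = \sum_(m <- msupp (g \mPo to_unit_box))
  ((g \mPo to_unit_box)@_m)%:MP * \prod_i unit_coord i ^+ m i.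
Proof.
pose t := [tuple unit_coord i | i < N].
have E : (g \mPo to_unit_box) \mPo t = g.
  rewrite [in LHS](comp_mpolyE g) raddf_sum [RHS]mpolyE; apply: eq_bigr => m _ /=.
  rewrite comp_mpolyZ; congr (_ *: _); rewrite rmorph_prod mpolyXE_id.
  apply: eq_bigr => i _; rewrite rmorphXn tnth_mktuple /=; congr (_ ^+ _).
  rewrite rmorphB rmorphM rmorph_nat rmorph1 /= comp_mpolyXU -tnth_nth tnth_mktuple.
  rewrite /unit_coord mulrA -(rmorph_nat (@mpolyC N R)) -rmorphM mulfV ?pnatr_eq0 //.
  by rewrite rmorph1 mul1r addrC addKr.
rewrite -[LHS]E comp_mpolyE; apply: eq_bigr => m _; rewrite mul_mpolyC; congr (_ *: _).
by apply: eq_bigr => i _; rewrite tnth_mktuple.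
Qed.

(** The Bernstein coefficient of [g] at the node [k]: the value of [g] at the
grid point [k / m] of the unit box, with falling factorials for the powers. *)
Definition node_value (m : nat) g (k : {ffun 'I_N -> 'I_m.+1}) : R :=
  \sum_(a <- msupp (g \mPo to_unit_box))
    (g \mPo to_unit_box)@_a * \prod_i node_power R m (a i) (k i).

Lemma node_value_depends m V g : poly_in V g -> depends_on V (@node_value m g).
Proof.
move=> /poly_in_to_unit_box/poly_inP gV k k' kk'; rewrite /node_value !big_seq.
apply: eq_bigr => a ag; congr (_ * _); apply: eq_bigr => i _.
have [iV|iV] := boolP (i \in V); first by rewrite kk'.
by rewrite (gV a) // /node_power !ffactn0.
Qed.

Lemma bernstein_op_node_value m g : (msize (g \mPo to_unit_box) <= m)%N ->
  bernstein_op (@mpolyC N R) unit_coord (@node_value m g) = g.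
Proof.
move=> sz; rewrite bernstein_op_sum [RHS]unit_coordE !big_seq; apply: eq_bigr => a ag.
rewrite bernstein_opZ; congr (_ * _); apply: bernstein_op_monomial => i.
apply: leq_trans sz; apply: leq_trans (ltnW (msize_mdeg_lt ag)).
by rewrite mdegE (bigD1 i) //= leq_addr.
Qed.

Definition node_error g : R := \sum_(a <- msupp (g \mPo to_unit_box))
  `|(g \mPo to_unit_box)@_a| * \sum_i ((a i) ^ 2)%:R.

Lemma node_value_approx m g (k : {ffun 'I_N -> 'I_m.+1}) : (0 < m)%N ->
    (msize (g \mPo to_unit_box) <= m)%N ->
  `|node_value g k - g.@[fun i => 2%:R * ((k i)%:R / m%:R) - 1]| <= node_error g / m%:R.
Proof.
move=> m_gt0 sz; pose x i : R := (k i)%:R / m%:R.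
have -> : g.@[fun i => 2%:R * ((k i)%:R / m%:R) - 1] = (g \mPo to_unit_box).@[x].
  rewrite comp_mpoly_meval; apply: meval_eq => i.
  by rewrite tnth_mktuple mevalB mevalM mevalXU meval1 -(rmorph_nat (@mpolyC N R)) mevalC.
rewrite /node_value mevalE /node_error; set h := g \mPo to_unit_box in sz *.
rewrite -sumrB mulr_suml; apply: le_trans (ler_norm_sum _ _ _) _.
rewrite !big_seq; apply: ler_sum => a ag.
rewrite -mulrBr normrM -mulrA; apply: ler_wpM2l => //; rewrite mulr_suml.
have am i : (a i <= m)%N.
  apply: leq_trans sz; apply: leq_trans (ltnW (msize_mdeg_lt ag)).
  by rewrite mdegE (bigD1 i) //= leq_addr.
have km i : (k i <= m)%N by rewrite -ltnS.
apply: prod_approx => i.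
- exact: node_power_itv.
- have x01 : 0 <= x i <= 1.
    by rewrite divr_ge0 //= ler_pdivrMr ?ltr0n // mul1r ler_nat.
  by case/andP: x01 => x0 x1; rewrite exprn_ge0 // exprn_ile1.
- exact: node_power_approx.
Qed.

End Coordinates.

Section SparseBox.
Variables (R : realType) (N : nat) (G : rel 'I_N).
Hypotheses (G_sym : ssrbool.symmetric G) (G_irr : irreflexive G).
Hypothesis G_chordal : chordal G.
Variables (q : nat) (U : 'I_q -> {set 'I_N}).
Hypothesis U_clique : forall l, cliqueb G (U l).
Hypothesis U_cover : forall A, cliqueb G A -> exists l, A \subset U l.

(** The Bernstein coefficients of the sum are positive on a fine enough grid.
They split along the cliques into nonnegative coefficients, and a Bernstein
polynomial with nonnegative coefficients is in the closure of the module of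
its clique.  The positive constant [d] kept aside for each clique brings it
into the module itself. *)
Theorem sparse_box_positivstellensatz (g : 'I_q -> {mpoly R[N]}) (e : R) :
    (forall l, poly_in (U l) (g l)) -> 0 < e ->
    (forall x, (forall i, -1 <= x i <= 1) -> e <= \sum_l (g l).@[x]) ->
  exists t : 'I_q -> {mpoly R[N]},
    (forall l, box_module (U l) (t l)) /\ \sum_l g l = \sum_l t l.
Proof.
move=> gU e_gt0 g_ge.
have [l0 _] : exists l, set0 \subset U l.
  by apply: U_cover; apply/forall_inP => x; rewrite inE.
have q_gt0 : 0 < q%:R :> R by rewrite ltr0n (leq_ltn_trans _ (ltn_ord l0)).
pose err := \sum_l node_error (g l).
have err_ge0 : 0 <= err.
  apply: sumr_ge0 => l _; apply: sumr_ge0 => a _.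
  by rewrite mulr_ge0 ?sumr_ge0.
pose d := e / 2%:R / q%:R; have d_gt0 : 0 < d by rewrite !divr_gt0.
(* The coefficients differ from the values by at most err / m <= e / 2 in total,
   and q * d = e / 2 is kept aside. *)
have [m [m_gt0 m_size m_err]] : exists m, [/\ (0 < m)%N,
    forall l, (msize (g l \mPo to_unit_box R N) <= m)%N & err / m%:R <= e / 2%:R].
  pose m1 := Num.bound (err / (e / 2%:R)).
  have m1P : err / (e / 2%:R) < m1%:R by apply: archi_boundP; rewrite !divr_ge0 // ltW.
  exists (m1 + \sum_l msize (g l \mPo to_unit_box R N)).+1; split=> // [l|].
    by rewrite (bigD1 l) //= addnCA -addnS leq_addr.
  rewrite ler_pdivrMr // mulrC -ler_pdivrMr ?divr_gt0 //.
  by apply: le_trans (ltW m1P) _; rewrite ler_nat -addnS leq_addr.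
pose phi l (k : {ffun 'I_N -> 'I_m.+1}) := node_value (g l) k - d.
have phiU l : depends_on (U l :&: [set: 'I_N]) (phi l).
  rewrite setIT => k k' kk'; congr (_ - _).
  by apply: (node_value_depends (gU l)).
have phi_ge0 (k : {ffun 'I_N -> 'I_m.+1}) : 0 <= \sum_l phi l k.
  pose x i : R := 2%:R * ((k i)%:R / m%:R) - 1.
  have x_box i : -1 <= x i <= 1.
    have k0 : 0 <= ((k i)%:R / m%:R : R) by rewrite divr_ge0.
    have k1 : (k i)%:R / m%:R <= 1 :> R.
      by rewrite ler_pdivrMr ?ltr0n // mul1r ler_nat -ltnS.
    by rewrite /x; lra.
  have gx := g_ge x x_box.
  have near : `|\sum_l node_value (g l) k - \sum_l (g l).@[x]| <= e / 2%:R.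
    rewrite -sumrB; apply: le_trans (ler_norm_sum _ _ _) _.
    apply: le_trans m_err; rewrite mulr_suml; apply: ler_sum => l _.
    exact: node_value_approx.
  rewrite sumrB sumr_const card_ord -[d *+ q]mulr_natr divfK ?gt_eqF //.
  by move: near; rewrite ler_norml => /andP[]; lra.
have [psi [psiU psi_ge0 sum_psi]] :=
  nonneg_clique_sum_in ord0 G_sym G_irr G_chordal U_clique U_cover phiU phi_ge0.
pose B := bernstein_op (@mpolyC N R) (@unit_coord R N).
exists (fun l => B m (psi l) + d%:MP); split=> [l|].
  apply: (bernstein_op_closure (poly_in_subalgebra R (U l)) (box_module_qm R (U l))
            (@box_module_archimedean R N (U l)) (B := U l)) => //.
    by rewrite -[U l]setIT.
  by move=> i iU; apply: unit_coord_interval.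
rewrite big_split /= -bernstein_op_sum.
have -> : bernstein_op (@mpolyC N R) (@unit_coord R N) (fun k => \sum_l psi l k)
        = \sum_l B m (phi l).
  rewrite -bernstein_op_sum; apply: eq_bigr => k _; by rewrite sum_psi.
rewrite -big_split /=; apply: eq_bigr => l _.
rewrite -{1}(bernstein_op_node_value (m_size l)) -(bernstein_opC _ (@unit_coord R N) m d).
rewrite -big_split /=; apply: eq_bigr => k _.
by rewrite -mulrDl -rmorphD subrK.
Qed.

End SparseBox.

(** * Exact penalties on the box *)

Section Compactness.
Import boolp classical_sets topology normedtype derive.
Import numFieldNormedType.Exports.

Lemma meval_continuous (R : realType) N (g : {mpoly R[N]}) :
  continuous (fun v : 'rV[R]_N => g.@[v ord0]).
Proof.
have gT : poly_in [set: 'I_N] g by move=> i _; rewrite finset.in_setT.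
elim/poly_in_ind: gT => [c|i _|g1 g2 c1 c2|g1 g2 c1 c2] v.
- under eq_fun do rewrite mevalC.
  exact: cst_continuous.
- under eq_fun do rewrite mevalXU.
  exact: coord_continuous.
- under eq_fun do rewrite mevalD.
  by apply: continuousD; [apply: c1 | apply: c2].
- under eq_fun do rewrite mevalM.
  by apply: continuousM; [apply: c1 | apply: c2].
Qed.

(** Where [F] is not positive, [H] is; so [`|F| + F + H] is positive, and has a
positive minimum on the compact box.  A large multiple of [H] then compensates
for the lower bound of [F]. *)
Lemma penalty_on_box (R : realType) N (F H : {mpoly R[N]}) :
    (forall x, 0 <= H.@[x]) -> (forall x, H.@[x] = 0 -> 0 < F.@[x]) ->
  exists lam e : R, [/\ 0 <= lam, 0 < e &
    forall x, (forall i, -1 <= x i <= 1) -> e <= F.@[x] + lam * H.@[x]].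
Proof.
move=> H_ge0 F_gt0.
pose box := ([set v : 'rV[R]_N | forall i, `[-1, 1] (v ord0 i)])%classic.
have box0 : (box !=set0)%classic.
  by exists 0 => i; rewrite /= mxE in_itv /= lerN10 ler01.
have box_compact : compact box.
  exact (@rV_compact R N (fun=> `[-1, 1]%classic) (fun=> @segment_compact R (-1) 1)).
have min_on_box (f : 'rV[R]_N -> R) : continuous f ->
    exists2 c, c \in box & forall x, (forall i, -1 <= x i <= 1) -> f c <= f (\row_i x i).
  move=> cf; have [c cbox c_min] := compact_EVT_min box0 box_compact (continuous_subspaceT cf).
  exists c => // x x_box; apply: c_min; rewrite inE => i /=.
  by rewrite mxE in_itv /= x_box.
have evE (g : {mpoly R[N]}) x : g.@[(\row_i x i : 'rV[R]_N) ord0] = g.@[x].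
  by apply: meval_eq => i; rewrite mxE.
have cF := @meval_continuous R N F; have cH := @meval_continuous R N H.
have [c1 _ F_min] := min_on_box _ cF.
pose f (v : 'rV[R]_N) := `|F.@[v ord0]| + F.@[v ord0] + H.@[v ord0].
have cf : continuous f.
  move=> v; apply: continuousD (cH v); apply: continuousD (cF v).
  exact: continuous_comp (cF v) (@norm_continuous _ R _).
have [c _ fc_min] := min_on_box f cf.
pose mu : R := f c.
have mu_gt0 : 0 < mu.
  rewrite /mu /f; have := H_ge0 (c ord0); rewrite le_eqVlt => /predU1P[H0|Hc].
    have Fc := F_gt0 _ (esym H0).
    by rewrite -H0 addr0 addr_gt0 // normr_gt0 gt_eqF.
  by have := ler_norm (- F.@[c ord0]); rewrite normrN; lra.
have mu_ge0 := ltW mu_gt0; pose b : R := F.@[c1 ord0].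
pose r : R := (`|b| + mu) / mu.
have r_ge0 : 0 <= r by apply: divr_ge0 => //; apply: addr_ge0.
have r_mu : r * mu = `|b| + mu by rewrite divfK ?gt_eqF.
exists (1 + r), (mu / 2%:R); split; [exact: addr_ge0 | exact: divr_gt0 |].
move=> x x_box; have := fc_min x x_box; have := F_min x x_box.
rewrite -/mu /f !evE -/b; have := H_ge0 x.
move: F.@[x] H.@[x] => s t t_ge0 b_le mu_le.
clearbody mu b r; have rt_ge0 : 0 <= r * t by apply: mulr_ge0.
have [s_ge0|s_lt0] := leP 0 s; first by rewrite ger0_norm // in mu_le; lra.
rewrite ltr0_norm // addNr add0r in mu_le.
have : r * mu <= r * t by rewrite ler_wpM2l.
by rewrite r_mu; have := ler_norm (- b); rewrite normrN; lra.
Qed.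

End Compactness.

(** * Positivity of the homogenization *)

Section Homogenization.
Variables (R : realType) (n p : nat) (f : {mpoly R[n]}).
Implicit Types (u : 'I_(n.+1 + p) -> R) (x : 'I_n -> R).

Lemma meval_homogenization u :
  (homogenization (p := p) f).@[u] = \sum_(m <- msupp f)
    f@_m * (u (iX0 n p) ^+ (mpdeg f - mdeg m) * \prod_(i < n) u (iX p i) ^+ m i).
Proof.
rewrite /homogenization raddf_sum; apply: eq_bigr => m _ /=.
rewrite mevalZ mevalM rmorphXn /= mevalXU rmorph_prod; congr (_ * (_ * _)).
by apply: eq_bigr => i _; rewrite rmorphXn /= mevalXU.
Qed.

Lemma mdeg_le_mpdeg m : m \in msupp f -> (mdeg m <= mpdeg f)%N.
Proof. by move=> /msize_mdeg_lt mf; rewrite /mpdeg -ltnS (leq_trans mf) // leqSpred. Qed.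

Lemma meval_top_form x :
  (top_form f).@[x] = \sum_(m <- msupp f | mdeg m == mpdeg f) f@_m * \prod_i x i ^+ m i.
Proof.
rewrite /top_form pihomogE raddf_sum; apply: eq_bigr => m _ /=.
by rewrite mevalZ mevalX.
Qed.

(** The values at [1] and at [-1] of a form of odd degree are opposite. *)
Lemma mpdeg_even : positive_definite (top_form f) -> ~~ odd (mpdeg f).
Proof.
move=> f_top; have [n0|n_gt0] := posnP n.
  suff -> : mpdeg f = 0%N by [].
  apply/eqP; rewrite /mpdeg -subn1 subn_eq0 msizeE; apply/bigmax_leqP_seq => m _ _.
  by rewrite ltnS mdegE big1 // => i; have := ltn_ord i; rewrite {2}n0.
have pos c : c != 0 -> 0 < (top_form f).@[fun=> c].
  by move=> c0; apply: f_top; exists (Ordinal n_gt0).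
have := pos (-1); rewrite oppr_eq0 oner_eq0 => /(_ isT).
have -> : (top_form f).@[fun=> -1] = (-1) ^+ mpdeg f * (top_form f).@[fun=> 1].
  rewrite !meval_top_form mulr_sumr; apply: eq_bigr => m /eqP mf.
  rewrite mulrCA; congr (_ * _); rewrite [X in _ * X]big1 => [|i _]; last exact: expr1n.
  by rewrite mulr1 -mf mdegE prodrXr.
have := pos 1 (oner_neq0 _); set s := _.@[_] => s_gt0.
rewrite pmulr_lgt0 // -signr_odd; case: odd => //.
by rewrite expr1 ltr0N1.
Qed.

(** Off the hyperplane [x_0 = 0] the homogenization is [x_0 ^+ d], with [d] even,
times a value of [f]; on it, it is the top form. *)
Lemma homogenization_gt0 u :
    (forall x, 0 < f.@[x]) -> positive_definite (top_form f) ->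
    (exists i, u (lshift p i) != 0) ->
  0 < (homogenization (p := p) f).@[u].
Proof.
move=> f_pos f_top [i ui]; rewrite meval_homogenization.
have [u0|u0] := eqVneq (u (iX0 n p)) 0; last first.
  have ud : 0 < u (iX0 n p) ^+ mpdeg f.
    by rewrite exprn_even_gt0 ?u0 ?orbT // mpdeg_even.
  have := f_pos (fun i => u (iX p i) / u (iX0 n p)).
  rewrite -(pmulr_rgt0 _ ud) mevalE mulr_sumr; congr (_ < _).
  rewrite !big_seq; apply: eq_bigr => m mf; rewrite mulrCA; congr (_ * _).
  rewrite -{1}(subnK (mdeg_le_mpdeg mf)) exprD -mulrA; congr (_ * _).
  under eq_bigr do rewrite exprMn exprVn.
  by rewrite big_split /= prodfV mulrCA mdegE prodrXr divff ?mulr1 // expf_neq0.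
have : 0 < (top_form f).@[fun i => u (iX p i)].
  apply: f_top; case: (unliftP ord0 i) ui => [j ->|->]; first by exists j.
  by rewrite u0 eqxx.
rewrite meval_top_form; congr (_ < _); rewrite big_mkcond !big_seq.
apply: eq_bigr => m /mdeg_le_mpdeg mf; rewrite u0 expr0n subn_eq0.
have -> : (mpdeg f <= mdeg m)%N = (mdeg m == mpdeg f) by rewrite eqn_leq mf.
by case: eqP; rewrite ?mul1r ?mul0r ?mulr0.
Qed.

End Homogenization.

(** If [x_0] and all [x_i] vanish, the first [p] constraints force [w_l ^+ 2 = 1]
for every [l], whereas the last one says that these squares add up to [p - 1]. *)
Lemma constraints_nonzero (R : realType) (n p : nat) (xs : 'I_p -> {set 'I_n})
    (u : 'I_(n.+1 + p) -> R) :
    (forall j, (hprime xs j : {mpoly R[n.+1 + p]}).@[u] = 0) ->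
  exists i, u (lshift p i) != 0.
Proof.
move=> hu; apply/existsP; apply: contraT; rewrite negb_exists => /forallP u0.
have {}u0 i : u (lshift p i) = 0 by apply/eqP; have := u0 i; rewrite negbK.
have w1 l : u (iW n l) ^+ 2 = 1.
  have := hu (lift ord_max l); rewrite /hprime liftK /hl.
  rewrite mevalB meval1 !mevalD raddf_sum mevalZ !rmorphXn /= !mevalXU u0.
  rewrite big1 => [|i _]; last by rewrite mevalZ rmorphXn /= mevalXU u0 expr0n mulr0.
  by rewrite expr0n mulr0 !add0r => /eqP; rewrite subr_eq0 => /eqP.
have := hu ord_max; rewrite /hprime unlift_none /hlast.
rewrite mevalD meval1 mevalB raddf_sum rmorph_nat /=.
rewrite (eq_bigr (fun=> 1)) => [|l _]; last by rewrite rmorphXn /= mevalXU w1.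
by rewrite sumr_const card_ord subrr add0r => /eqP; rewrite oner_eq0.
Qed.

(** * The sparse representation *)

Lemma poly_in_monomialX (R : realType) N (V : {set 'I_N}) (m : 'X_{1..N}) :
  [set i | m i != 0%N] \subset V -> poly_in V ('X_[m] : {mpoly R[N]}).
Proof.
move=> /subsetP mV; apply/poly_inP => m'; rewrite /= => i.
by rewrite msuppX inE => /eqP-> iV; apply: contraNeq iV => mi; apply: mV; rewrite inE.
Qed.

Theorem theorem4p4 (R : realType) (n p q : nat) (f : {mpoly R[n]})
    (xs : 'I_p -> {set 'I_n})
    (G : rel 'I_(n.+1 + p)) (U : 'I_q -> {set 'I_(n.+1 + p)})
    (I : 'I_q -> {set 'I_p.+1})
    (f_csp : csp_pattern xs f)
    (G_ext : chordal_extension (csp_adj xs f) G)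
    (U_cliques : lists_max_cliques G U)
    (I_part : partition_family I)
    (I_in : forall (l : 'I_q) (j : 'I_p.+1),
       j \in I l -> poly_in (U l) (hprime xs j : {mpoly R[n.+1 + p]}))
    (f_pos : forall x : 'I_n -> R, 0 < f.@[x])
    (f_top : positive_definite (top_form f)) :
  exists (sigma0 : 'I_q -> {mpoly R[n.+1 + p]})
         (sigma : 'I_q -> 'I_(n.+1 + p) -> {mpoly R[n.+1 + p]})
         (tau : 'I_q -> 'I_p.+1 -> {mpoly R[n.+1 + p]}),
    [/\ forall l, sos_in (U l) (sigma0 l),
        forall l i, i \in U l -> sos_in (U l) (sigma l i),
        forall l j, j \in I l -> poly_in (U l) (tau l j) &
        homogenization f =
          \sum_(l < q)
            (sigma0 l + \sum_(i in U l) sigma l i * (1 - 'X_i ^+ 2)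
             + \sum_(j in I l) tau l j * hprime xs j)].
Proof.
case: G_ext => G_sym G_irr G_chordal G_adj.
have U_clique l : cliqueb G (U l) by apply: maxsetp; apply/(U_cliques.2); exists l.
have U_cover A : cliqueb G A -> exists l, A \subset U l.
  by case/maxset_exists => B /U_cliques.2[l <-]; exists l.
set F := homogenization f.
pose H : {mpoly R[n.+1 + p]} := \sum_l \sum_(j in I l) hprime xs j ^+ 2.
have H_eval x : H.@[x] = \sum_l \sum_(j in I l) (hprime xs j).@[x] ^+ 2.
  rewrite raddf_sum; apply: eq_bigr => l _ /=; rewrite raddf_sum.
  by apply: eq_bigr => j _; rewrite /= rmorphXn.
have sq_ge0 x l : 0 <= \sum_(j in I l) (hprime xs j : {mpoly R[n.+1 + p]}).@[x] ^+ 2.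
  by apply: sumr_ge0 => j _; apply: sqr_ge0.
have H_ge0 x : 0 <= H.@[x] by rewrite H_eval; apply: sumr_ge0.
have F_gt0 x : H.@[x] = 0 -> 0 < F.@[x].
  rewrite H_eval => Hx; apply: homogenization_gt0 => //.
  apply: (constraints_nonzero (xs := xs)) => j.
  have /bigcupP[l _ jl] : j \in \bigcup_l I l by rewrite I_part.1 inE.
  have Hl : \sum_(j in I l) (hprime xs j : {mpoly R[n.+1 + p]}).@[x] ^+ 2 = 0.
    exact: (psumr_eq0P _ Hx).
  have /eqP := psumr_eq0P (fun j _ => sqr_ge0 _) Hl jl.
  by rewrite sqrf_eq0 => /eqP.
have [lam [e [lam_ge0 e_gt0 pen]]] := penalty_on_box H_ge0 F_gt0.
have supp_clique m : m \in msupp F -> cliqueb G [set i | m i != 0%N].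
  move=> mF; apply/forall_inP => i; rewrite inE => mi.
  apply/forall_inP => j; rewrite inE => mj; apply/implyP => ij; apply: G_adj.
  by split=> //; left; exists 0, m; rewrite scale0r subr0.
have [l0 _] : exists l, set0 \subset U l.
  by apply: U_cover; apply/forall_inP => x; rewrite inE.
(* Each monomial is assigned to one maximal clique that contains its variables. *)
pose home (m : 'X_{1..n.+1 + p}) := odflt l0 [pick l | [set i | m i != 0%N] \subset U l].
have homeP m : m \in msupp F -> [set i | m i != 0%N] \subset U (home m).
  move=> /supp_clique/U_cover[l ml]; rewrite /home; case: pickP => //= /(_ l).
  by rewrite ml.
pose F_ l := \sum_(m <- msupp F | home m == l) F@_m *: 'X_[m].
have F_U l : poly_in (U l) (F_ l).
  rewrite /F_ big_seq_cond; apply: poly_in_sum => m /andP[mF /eqP <-].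
  by apply/poly_inZ/poly_in_monomialX/homeP.
have sum_F : F = \sum_l F_ l by rewrite [LHS]mpolyE (partition_big home xpredT).
pose g l := F_ l + lam *: \sum_(j in I l) hprime xs j ^+ 2.
have g_U l : poly_in (U l) (g l).
  apply: poly_inD => //; apply: poly_inZ; apply: poly_in_sum => j jl.
  by apply/poly_inXn/I_in.
have sum_g : \sum_l g l = F + lam *: H.
  by rewrite big_split /= -sum_F -scaler_sumr.
have g_ge x : (forall i, -1 <= x i <= 1) -> e <= \sum_l (g l).@[x].
  move=> x_box; have := pen x x_box; rewrite -mevalZ -mevalD -sum_g.
  by rewrite raddf_sum.
have [t [t_in sum_t]] :=
  sparse_box_positivstellensatz G_sym G_irr G_chordal U_clique U_cover g_U e_gt0 g_ge.
have [s0 s0P] := fin_all_exists t_in.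
have [s sP] := fin_all_exists s0P.
exists s0, s, (fun _ j => - (lam *: hprime xs j)); split.
- by move=> l; case: (sP l).
- by move=> l i; case: (sP l) => _ + _; apply.
- by move=> l j jl; rewrite -scaleN1r; do 2!apply: poly_inZ; apply: I_in.
rewrite big_split /=.
have -> : \sum_l (s0 l + \sum_(i in U l) s l i * (1 - 'X_i ^+ 2))
    = F + lam *: H.
  by rewrite -sum_g sum_t; apply: eq_bigr => l _; case: (sP l).
rewrite scaler_sumr -addrA -big_split big1 ?addr0 // => l _ /=.
rewrite scaler_sumr -big_split big1 // => j _ /=.
by rewrite mulNr -scalerAl -expr2 subrr.
Qed.
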